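(* There is an absolute constant $C>0$ such that the following holds. For every integer $n\geq 3$, with $N=2^n-1$ and $R=\mathbb{Z}/N\mathbb{Z}$, for all units $a_1,a_2\in R^\times$ and all weights $w_1,w_2\in W=\{0,\ldots,n-1\}$, \[ \left|R\setminus \mathrm{supp}(a_1 S_{w_1}+a_2 S_{w_2})\right|\leq C\,N\cdot\min\left\{1,\ \frac{N^4 n^{-3}}{|S_{w_1}|^2\,|S_{w_2}|^2}\right\}. \] Consequently, if $n\to\infty$ through integers, with the weights $w_j=w_j(n)$ and the units $a_j=a_j(n)$ allowed to vary with $n$, and if \[ \frac{|S_{w_1}|\,|S_{w_2}|}{\left(N\cdot n^{-3/4}\right)^2}\longrightarrow\infty, \] then \[ \left|\mathrm{supp}(a_1 S_{w_1}+a_2 S_{w_2})\right|=(1-o(1))\cdot N. \]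
   Context: For an integer $n\geq 3$ put $N=2^n-1$, $R=\mathbb{Z}/N\mathbb{Z}$ (neither $n$ nor $N$ is assumed prime), and $W=\{0,\ldots,n-1\}$. Each residue in $R$ is identified with its representative in $\{0,\ldots,2^n-2\}$, and $\mathrm{wt}(x)$ denotes the number of ones in the $n$-digit binary expansion of that representative. For $w\in W$, $S_w=\{x\in R:\mathrm{wt}(x)=w\}$, so $|S_w|=\binom{n}{w}$. For $a\in R^\times$ and $A\subseteq R$, $aA=\{ax: x\in A\}$. For $A_1,A_2\subseteq R$, $\mathrm{supp}(A_1+A_2)$ is the set of $x\in R$ that can be written as $x=s_1+s_2$ with $s_1\in A_1$, $s_2\in A_2$. All objects $R$, $W$, $S_w$ depend on $n$. *)

(* Defs.v *)
From HB Require Import structures.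
From mathcomp Require Import all_boot all_order all_algebra.

Set Implicit Arguments.
Unset Strict Implicit.
Unset Printing Implicit Defensive.

Import GRing.Theory.
Local Open Scope ring_scope.

Definition mersenne (n : nat) : nat := (2 ^ n - 1)%N.

(* ['Z_m] is the ring Z/mZ only for [1 < m], i.e. here for [2 <= n]; for
   [n < 2] the type below is Z/2Z. *)
Notation zmers n := 'Z_(mersenne n).

(* The [n]-digit binary expansion of the representative of [x] below [2 ^ n - 1]
   has [odd (x %/ 2 ^ i)] as its digit of index [i]. *)
Definition wt (n : nat) (x : zmers n) : nat :=
  (\sum_(i < n) odd (x %/ 2 ^ i))%N.
Arguments wt n x : clear implicits.

Definition layer (n w : nat) : {set zmers n} := [set x | wt n x == w].

Definition dilate (n : nat) (a : zmers n) (A : {set zmers n}) : {set zmers n} :=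
  [set a * x | x in A].

Definition supp_add (n : nat) (A1 A2 : {set zmers n}) : {set zmers n} :=
  [set s1 + s2 | s1 in A1, s2 in A2].

(* Main.v *)
Require Import Defs.
From mathcomp Require Import all_boot all_order all_algebra.
From mathcomp Require Import all_classical all_reals all_analysis.
From mathcomp Require Import all_solvable all_field.
From mathcomp Require Import complex.
From mathcomp Require Import ring lra zify.

Set Implicit Arguments.
Unset Strict Implicit.
Unset Printing Implicit Defensive.

Import Order.TTheory GRing.Theory Num.Theory.
Import numFieldNormedType.Exports.
Local Open Scope ring_scope.

(** Let [A1] and [A2] be the two dilated layers, [T] the set of missing sums, and
    write [f^] for the Fourier transform on Z/NZ.  The number of representations
    [r(x)] of [x] as a sum has mean [|A1||A2|/N] and vanishes on [T], so by Parseval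

      [|T| |A1|^2 |A2|^2 <= N * \sum_(t != 0) |A1^(t)|^2 |A2^(t)|^2]

    ([missing_sums_bound]).  Since [2 x y <= x^2 + y^2] and since a unit only permutes
    the frequencies, it suffices to bound the fourth moment of one layer [S_d]:

      [\sum_(t != 0) |S_d^(t)|^4 = O(16^n n^-3)]     ([layer_fourth_moment]).

    With [zeta] a primitive [N]-th root of unity, [S_d^(t)] is the coefficient of
    [w^d] in the Riesz product [P_w(z) = \prod_(i < n) (1 + w z^(2^i))] at
    [z = zeta^t], hence the mean of [w^(-d) P_w(z)] over the roots of unity [w] of
    order [m^2], where [m] is about [sqrt n].  Put [eps = |1 - w|^2].  The heart of
    the proof is the estimate

      [\sum_(t != 0) |P_w(zeta^t)|^4 = O(n 16^n (eps^2 (1 - eps/32)^n + 2^-n))]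

    ([riesz_nontrivial_sum]).  Integrated over [w] against Poisson kernel weights of
    width about [n^(-1/2)] it yields the fourth moment bound: the factor [eps^2]
    contributes [n^-2] on the relevant range, and the mean over [w] contributes the
    remaining powers.  The extremal frequencies are the powers of 2, for which one
    factor of the Riesz product nearly vanishes at [w = 1].

    The estimate for Riesz products is reached as follows.  A nonzero [t] has some
    doubling [2^i t] for which [|1 - zeta^(2^i t)| >= 1] ([doubling_orbit_escapes]),
    and [|P_w(zeta^t)|] is invariant under doubling of [t]; so it is at most [n] times
    the sum over all [t] with the additional weight [|1 - zeta^t|^2].  The weighted
    quantity is the squared modulus of a polynomial in [zeta^t] of degree less than
    [3 N], so by positivity and Parseval the sum over [N]-th roots of unity may be
    replaced by a mean over roots of unity of order [2^(n+2)]
    ([mersenne_difference_energy]).  There [z] and [-z] may be paired, and [P_w] for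
    [n + 1] factors reduces to [P_w(z^2)] for [n] factors.  Let [E] and [D] be the
    means of [|P_w|^4] without and with the weight [|1 - z|^2], divided by [8^n].
    For [eps <= 1/2] one step gives [D' <= D/2 + eps^2 E]
    ([difference_energy_step]), because at [w = 1] the weight contracts; and for
    every [w] two steps give [E'' <= (1 - eps/16) E] ([energy_two_steps]).  Solving
    this recursion gives [difference_energy_bound].

    The asymptotic statement follows: the proportion of missing sums is [O(X^-2)] for
    the ratio [X] that is assumed to tend to infinity. *)

(** * Squared moduli and weighted Cauchy-Schwarz inequalities *)

Section SquaredModulus.
Variable R : rcfType.
Implicit Types x y z : R[i].

(** The value is taken in [R], not in the partially ordered [R[i]], so that the
    inequalities below live in a totally ordered field. *)
Definition nsq z : R := complex.Re z ^+ 2 + complex.Im z ^+ 2.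

Lemma nsq_ge0 z : 0 <= nsq z.
Proof. by rewrite addr_ge0 ?sqr_ge0. Qed.

Lemma nsq0 : nsq 0 = 0. Proof. by rewrite /nsq /= expr0n addr0. Qed.
Lemma nsq1 : nsq 1 = 1. Proof. by rewrite /nsq /= expr0n expr1n addr0. Qed.

Lemma nsqM x y : nsq (x * y) = nsq x * nsq y.
Proof. case: x y => [a b] [c d]; rewrite /nsq /=; ring. Qed.

Lemma nsqX x k : nsq (x ^+ k) = nsq x ^+ k.
Proof. by elim: k => [|k IH]; rewrite ?nsq1 // !exprS nsqM IH. Qed.

Lemma nsqN x : nsq (- x) = nsq x.
Proof. by case: x => a b; rewrite /nsq /= !sqrrN. Qed.

Lemma nsqR (a : R) : nsq a%:C%C = a ^+ 2.
Proof. by rewrite /nsq /= expr0n addr0. Qed.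

Lemma nsq_conj z : (nsq z)%:C%C = z * conjc z.
Proof.
by case: z => a b; apply/eqP; rewrite eq_complex /nsq /=; apply/andP; split; apply/eqP; ring.
Qed.

Lemma parallelogram x y : nsq (x + y) + nsq (x - y) = 2 * (nsq x + nsq y).
Proof. case: x y => [a b] [c d]; rewrite /nsq /=; ring. Qed.

Lemma nsqD_le (k : R) x y : 0 < k ->
  nsq (x + y) <= (1 + k) * nsq x + (1 + k^-1) * nsq y.
Proof.
move=> k0; case: x y => [a b] [c d]; rewrite /nsq /= -subr_ge0.
suff -> : (1 + k) * (a ^+ 2 + b ^+ 2) + (1 + k^-1) * (c ^+ 2 + d ^+ 2) -
    ((a + c) ^+ 2 + (b + d) ^+ 2) = ((k * a - c) ^+ 2 + (k * b - d) ^+ 2) / k.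
  by rewrite divr_ge0 ?addr_ge0 ?sqr_ge0 ?ltW.
by field; rewrite gt_eqF.
Qed.

Lemma nsqD_ge x y : nsq y / 2 - nsq x <= nsq (x + y).
Proof.
case: x y => [a b] [c d]; rewrite /nsq /=.
by have := sqr_ge0 (2 * a + c); have := sqr_ge0 (2 * b + d); nra.
Qed.

(** This is [|1 - z^2| = |1 - z| |1 + z|], where the parallelogram law expresses
    [|1 + z|] through [|1 - z|]. *)
Lemma nsqB1_double z : nsq z = 1 -> nsq (1 - z ^+ 2) = nsq (1 - z) * (4 - nsq (1 - z)).
Proof.
move=> z1; have -> : 1 - z ^+ 2 = (1 - z) * (1 + z) by ring.
by rewrite nsqM; congr (_ * _); have := parallelogram 1 z; rewrite nsq1 z1; lra.
Qed.

Lemma nsqB1_le4 z : nsq z = 1 -> nsq (1 - z) <= 4.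
Proof.
by move=> z1; have := parallelogram 1 z; have := nsq_ge0 (1 + z); rewrite nsq1 z1; lra.
Qed.

(** For any real [V] and [Y] the sum of [(a i * V - u i * Y) ^+ 2 / u i] is
    nonnegative; the optimal choice is [V] the total weight and [Y] the sum of
    the [a i]. *)
Lemma sqr_sum_weighted (I : finType) (u a : I -> R) : (forall i, 0 < u i) ->
  (\sum_i a i) ^+ 2 <= (\sum_i u i) * \sum_i a i ^+ 2 / u i.
Proof.
move=> u0; set U := \sum_i u i; set X := \sum_i a i.
have [i0|noI] := pickP (fun _ : I => true); last first.
  by rewrite /X big_pred0 // expr0n mulr_ge0 ?sumr_ge0 // => i; have := noI i.
have U0 : 0 < U.
  by rewrite /U (bigD1 i0) //= ltr_wpDr ?u0 ?sumr_ge0 // => i _; apply: ltW.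
have : 0 <= \sum_i (a i * U - u i * X) ^+ 2 / u i.
  by apply: sumr_ge0 => i _; rewrite divr_ge0 ?sqr_ge0 ?ltW.
have expand V Y : \sum_i (a i * V - u i * Y) ^+ 2 / u i =
    V ^+ 2 * (\sum_i a i ^+ 2 / u i) - 2 * V * Y * X + Y ^+ 2 * U.
  rewrite /X /U !mulr_sumr -sumrB -big_split /=; apply: eq_bigr => i _.
  by field; rewrite gt_eqF.
by rewrite expand => H; rewrite -(ler_pM2l U0) mulrA; nra.
Qed.

Lemma nsq_sum_weighted (I : finType) (u : I -> R) (c : I -> R[i]) : (forall i, 0 < u i) ->
  nsq (\sum_i c i) <= (\sum_i u i) * \sum_i nsq (c i) / u i.
Proof.
move=> u0; rewrite /nsq.
rewrite (raddf_sum (@complex.Re R : Rcomplex R -> R)) (raddf_sum (@complex.Im R : Rcomplex R -> R)).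
apply: (le_trans (lerD (sqr_sum_weighted (fun i => complex.Re (c i)) u0)
  (sqr_sum_weighted (fun i => complex.Im (c i)) u0))).
rewrite -mulrDr -big_split /= le_eqVlt; apply/orP; left; apply/eqP; congr (_ * _).
by apply: eq_bigr => i _; rewrite -mulrDl.
Qed.

(** Hoelder's inequality with exponents 4 and 4/3, obtained by applying the
    weighted Cauchy-Schwarz inequality twice.  Equal weights would lose a power of
    [n] in the application, where the summands concentrate near one point. *)
Lemma nsq_sum_fourth (I : finType) (u : I -> R) (c : I -> R[i]) : (forall i, 0 < u i) ->
  nsq (\sum_i c i) ^+ 2 <= (\sum_i u i) ^+ 3 * \sum_i nsq (c i) ^+ 2 / u i ^+ 3.
Proof.
move=> u0; set U := \sum_i u i.
have U0 : 0 <= U by apply: sumr_ge0 => i _; apply: ltW.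
have S0 : 0 <= \sum_i nsq (c i) / u i.
  by apply: sumr_ge0 => i _; rewrite divr_ge0 ?nsq_ge0 ?ltW.
have h := nsq_sum_weighted c u0.
apply: (@le_trans _ _ ((U * \sum_i nsq (c i) / u i) ^+ 2)).
  by rewrite ler_sqr ?nnegrE ?nsq_ge0 ?mulr_ge0.
rewrite exprMn [U ^+ 3]exprSr -mulrA ler_wpM2l ?exprn_ge0 //.
apply: (le_trans (sqr_sum_weighted _ u0)); rewrite -/U ler_wpM2l //.
apply: ler_sum => i _; rewrite le_eqVlt; apply/orP; left; apply/eqP.
by field; rewrite gt_eqF.
Qed.

End SquaredModulus.

(** * Parseval's identity on roots of unity *)

Section RootsOfUnity.
Variable R : rcfType.

(** The roots of [X^K - 1] are distinct, and a finite group of roots of unity in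
    a field is cyclic. *)
Lemma complex_prim_root_exists K : (0 < K)%N -> exists z : R[i], K.-primitive_root z.
Proof.
move=> K0; have [rs Drs] := closed_field_poly_normal ('X^K - 1 : {poly R[i]}).
rewrite (monicP (monicXnsubC 1 K0)) scale1r in Drs.
have unit_rs : all K.-unity_root rs.
  by apply/allP=> z zrs; rewrite /root_of_unity Drs root_prod_XsubC.
have size_rs : (K <= size rs)%N.
  by rewrite -ltnS -(size_prod_XsubC rs id) -Drs size_XnsubC.
have uniq_rs : uniq rs.
  by rewrite -separable_prod_XsubC -Drs separable_Xn_sub_1 // pnatr_eq0 -lt0n.
by have /hasP[z _ zP] := has_prim_root K0 unit_rs uniq_rs size_rs; exists z.
Qed.

Lemma nsq_prim_root K (z : R[i]) : K.-primitive_root z -> nsq z = 1.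
Proof.
move=> zP; have K0 := prim_order_gt0 zP; apply/eqP.
by rewrite -(@pexpr_eq1 _ _ K) ?nsq_ge0 // -nsqX (prim_expr_order zP) nsq1.
Qed.

Lemma nsq_prim_rootX K (z : R[i]) k : K.-primitive_root z -> nsq (z ^+ k) = 1.
Proof. by move=> zP; rewrite nsqX (nsq_prim_root zP) expr1n. Qed.

Lemma prim_root_ortho K (z : R[i]) (k l : 'I_K) : K.-primitive_root z ->
  \sum_(j < K) z ^+ (j * k) * conjc (z ^+ (j * l)) = if k == l then K%:R else 0.
Proof.
move=> zP; have zu m : z ^+ m * conjc (z ^+ m) = 1.
  by rewrite -nsq_conj (nsq_prim_rootX m zP).
pose x := z ^+ k * conjc (z ^+ l).
have -> : \sum_(j < K) z ^+ (j * k) * conjc (z ^+ (j * l)) = \sum_(j < K) x ^+ j.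
  by apply: eq_bigr => j _; rewrite /x exprMn -rmorphXn /= -!exprM ![(_ * j)%N]mulnC.
case: eqP => [kl|/eqP nkl].
  rewrite /x kl zu (eq_bigr (fun=> 1)) => [|j _]; last by rewrite expr1n.
  by rewrite sumr_const card_ord.
have xK : x ^+ K = 1.
  rewrite /x exprMn -rmorphXn /= -!exprM ![(_ * K)%N]mulnC !exprM.
  by rewrite (prim_expr_order zP) !expr1n rmorph1 mulr1.
have x1 : x != 1.
  apply: contra nkl => /eqP x1; rewrite -val_eqE /=.
  have : z ^+ k == z ^+ l.
    by apply/eqP; rewrite -[LHS]mulr1 -(zu l) mulrCA -/x x1 mulr1.
  by rewrite (eq_prim_root_expr zP) !modn_small.
have := subrX1 x K; rewrite xK subrr => /esym/eqP.
by rewrite mulf_eq0 subr_eq0 (negPf x1) => /eqP.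
Qed.

Lemma parseval K (z : R[i]) (a : 'I_K -> R[i]) : K.-primitive_root z ->
  \sum_(j < K) nsq (\sum_k a k * z ^+ (j * k)) = K%:R * \sum_k nsq (a k).
Proof.
move=> zP; apply: (fmorph_inj (real_complex R)); rewrite rmorphM rmorph_nat !rmorph_sum /=.
pose F k l := a k * conjc (a l) * \sum_(j < K) z ^+ (j * k) * conjc (z ^+ (j * l)).
transitivity (\sum_k \sum_l F k l).
  rewrite /F; under [RHS]eq_bigr do under eq_bigr do rewrite mulr_sumr.
  under [RHS]eq_bigr do rewrite exchange_big /=.
  rewrite [RHS]exchange_big /=; apply: eq_bigr => j _.
  rewrite nsq_conj rmorph_sum /= mulr_suml; apply: eq_bigr => k _.
  rewrite mulr_sumr; apply: eq_bigr => l _.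
  by rewrite rmorphM /= mulrACA.
rewrite mulr_sumr; apply: eq_bigr => k _.
rewrite (bigD1 k) //= big1 => [|l lk]; last first.
  by rewrite /F (prim_root_ortho _ _ zP) eq_sym (negPf lk) mulr0.
by rewrite addr0 /F (prim_root_ortho _ _ zP) eqxx nsq_conj mulrC.
Qed.

(** The right-hand side divided by [K] does not depend on [K]: the mean of
    [nsq q] is the same over every group of roots of unity whose order is at least
    the number of coefficients of [q].  This allows replacing one order by
    another. *)
Lemma parseval_poly K (z : R[i]) (q : {poly R[i]}) : K.-primitive_root z -> (size q <= K)%N ->
  \sum_(j < K) nsq q.[z ^+ j] = K%:R * \sum_(k < size q) nsq q`_k.
Proof.
move=> zP sq.
have -> : \sum_(k < size q) nsq q`_k = \sum_(k < K) nsq q`_k.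
  rewrite -(big_mkord xpredT (fun k => nsq q`_k)) -(big_mkord xpredT (fun k => nsq q`_k)).
  rewrite [RHS](big_cat_nat (n := size q)) //= [X in _ = _ + X]big_nat_cond.
  by rewrite [X in _ = _ + X]big1 ?addr0 // => k /andP[/andP[hk _] _]; rewrite nth_default // nsq0.
rewrite -(parseval _ zP); apply: eq_bigr => j _.
rewrite (horner_coef_wide _ sq); congr nsq; apply: eq_bigr => k _.
by rewrite -exprM.
Qed.

End RootsOfUnity.

(** * Riesz products: contraction under squaring *)

Section Riesz.
Variable R : rcfType.
Implicit Types (w z xi : R[i]) (g : R[i] -> R).

(** Expanding the product gives the generating function of the binary digit sum,
    with [w] marking the digit sum and [z] the integer ([riesz_digit_sum]). *)
Definition riesz w n z : R[i] := \prod_(i < n) (1 + w * z ^+ (2 ^ i)).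

Lemma riesz0 w z : riesz w 0 z = 1.
Proof. by rewrite /riesz big_ord0. Qed.

Lemma rieszS w n z : riesz w n.+1 z = (1 + w * z) * riesz w n (z ^+ 2).
Proof.
rewrite /riesz big_ord_recl /= expr1; congr (_ * _); apply: eq_bigr => i _.
by rewrite -exprM /bump /= add1n expnS.
Qed.

Definition weighted_energy w n g K xi : R :=
  \sum_(j < K) g (xi ^+ j) * nsq (riesz w n (xi ^+ j)) ^+ 2.

Lemma ler_weighted_energy w n g g' K xi : K.-primitive_root xi ->
  (forall z, nsq z = 1 -> g z <= g' z) -> weighted_energy w n g K xi <= weighted_energy w n g' K xi.
Proof.
move=> xiP gg'; apply: ler_sum => j _.
by rewrite ler_wpM2r ?sqr_ge0 // gg' // (nsq_prim_rootX j xiP).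
Qed.

Lemma prim_root_half K xi : (2 * K).-primitive_root xi ->
  K.-primitive_root (xi ^+ 2) /\ xi ^+ K = -1.
Proof.
move=> xiP; have K0 : (0 < K)%N by have := prim_order_gt0 xiP; rewrite muln_gt0.
split; first by have := dvdn_prim_root xiP (dvdn_mull 2 (dvdnn K)); rewrite mulnK.
have : (xi ^+ K) ^+ 2 == 1 by rewrite -exprM mulnC (prim_expr_order xiP).
rewrite sqrf_eq1 => /orP[|/eqP//]; rewrite -(prim_order_dvd xiP) => /(dvdn_leq K0).
by lia.
Qed.

(** The points [z] and [- z] have the same square, so by [rieszS] their Riesz
    products share the factor at [z ^+ 2]; summing over the pair leaves a sum
    over the roots of half the order, for the shorter product. *)
Lemma weighted_energy_step w n g g' K xi : (2 * K).-primitive_root xi ->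
  (forall z, nsq z = 1 ->
     g z * nsq (1 + w * z) ^+ 2 + g (- z) * nsq (1 - w * z) ^+ 2 <= 2 * g' (z ^+ 2)) ->
  weighted_energy w n.+1 g (2 * K) xi <= 2 * weighted_energy w n g' K (xi ^+ 2).
Proof.
move=> xiP gg'; have [_ xiK] := prim_root_half xiP.
have half (F : nat -> R) : \sum_(j < 2 * K) F j = \sum_(j < K) (F j + F (K + j)%N).
  by rewrite mul2n -addnn big_split_ord big_split.
rewrite /weighted_energy
  (half (fun j => g (xi ^+ j) * nsq (riesz w n.+1 (xi ^+ j)) ^+ 2)) mulr_sumr.
apply: ler_sum => j _.
rewrite exprD xiK mulN1r !rieszS mulrN sqrrN [xi ^+ 2 ^+ j]exprAC.
set z := xi ^+ j; rewrite !nsqM !(exprMn _ (nsq _)); set P := nsq _ ^+ 2.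
have z1 : nsq z = 1 := nsq_prim_rootX j xiP.
have P0 : 0 <= P by apply: sqr_ge0.
by have := ler_wpM2r P0 (gg' z z1); rewrite mulrDl !mulrA.
Qed.

Variable w : R[i].
Hypothesis w1 : nsq w = 1.
Let eps := nsq (1 - w).

(** The weight 1 is reproduced up to the factor 8, with a loss that is small only
    where [w ^+ 2 * z ^+ 2] is close to 1. *)
Lemma energy_step z : nsq z = 1 ->
  nsq (1 + w * z) ^+ 2 + nsq (1 - w * z) ^+ 2 = 2 * (8 - nsq (1 - w ^+ 2 * z ^+ 2)).
Proof.
move=> z1; have v1 : nsq (w * z) = 1 by rewrite nsqM w1 z1 mulr1.
rewrite -exprMn (nsqB1_double v1); have := parallelogram 1 (w * z).
rewrite nsq1 v1; set a := nsq (1 + _); set b := nsq (1 - _) => hab.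
have -> : a = 4 - b by lra.
ring.
Qed.

(** One step alone need not lose anything.  If the first step loses little at
    [z ^+ 2], then the loss at [z] or [- z] in the second step is at least
    proportional to [|1 - w|^2]: both parts [e] and [o] of the product
    [(1 - w^2 z) (1 + w z)^2] contain a term [2 w (1 - w)] up to a unit, next
    to a multiple of [1 - w^2 x]. *)
Lemma energy_two_steps z : nsq z = 1 ->
  (8 - nsq (1 - w ^+ 2 * z)) * nsq (1 + w * z) ^+ 2 +
  (8 - nsq (1 - w ^+ 2 * - z)) * nsq (1 - w * z) ^+ 2 <= 2 * (64 - 4 * eps).
Proof.
move=> z1; have x1 : nsq (z ^+ 2) = 1 by rewrite nsqX z1 expr1n.
set x := z ^+ 2 in x1; set b := nsq (1 - w ^+ 2 * x).
(* [e] and [z * o] are the even and odd parts in [z], with [x = z ^+ 2]. *)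
pose e := 1 - w ^+ 2 * x + 2 * w ^+ 2 * (1 - w) * x.
pose o := w ^+ 2 * (1 - w ^+ 2 * x) + 2 * w * (1 - w).
have eo : nsq (1 - w ^+ 2 * z) * nsq (1 + w * z) ^+ 2 +
    nsq (1 - w ^+ 2 * - z) * nsq (1 - w * z) ^+ 2 = 2 * (nsq e + nsq o).
  have -> : nsq o = nsq (z * o) by rewrite nsqM z1 mul1r.
  rewrite -parallelogram -!nsqX -!nsqM; congr (nsq _ + nsq _); rewrite /e /o /x; ring.
have n2 : nsq (2 : R[i]) = 4 by rewrite -[2 in LHS](rmorph_nat (real_complex R)) nsqR; ring.
have he : 2 * eps - b <= nsq e.
  apply: le_trans (nsqD_ge _ _).
  by rewrite (nsqM _ x) (nsqM _ (1 - w)) (nsqM 2) nsqX n2 w1 x1 -/eps -/b; lra.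
have ho : 2 * eps - b <= nsq o.
  apply: le_trans (nsqD_ge _ _).
  by rewrite (nsqM (w ^+ 2)) (nsqM _ (1 - w)) (nsqM 2) nsqX n2 w1 -/eps -/b; lra.
have b0 : 0 <= b := nsq_ge0 _.
have := energy_step z1; rewrite -/x -/b => h1.
by rewrite !mulrBl addrACA -mulrDr h1 -opprD eo; lra.
Qed.

(** At [w = 1] the identity [(1 - z) (1 + z)^2 = (1 - z^2) (1 + z)] shows that the
    weight [|1 - z|^2] is reproduced with factor 2, to be compared with the factor
    8 of the weight 1.  For other [w] the even and odd parts of
    [(1 - z) (1 + w z)^2] differ from multiples of [1 - z^2] by [(1 - w)^2]. *)
Lemma difference_energy_step z : nsq z = 1 -> eps <= 1 / 2 ->
  nsq (1 - z) * nsq (1 + w * z) ^+ 2 + nsq (1 - - z) * nsq (1 - w * z) ^+ 2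
  <= 2 * (4 * nsq (1 - z ^+ 2) + 8 * eps ^+ 2).
Proof.
move=> z1 eps_small; have x1 : nsq (z ^+ 2) = 1 by rewrite nsqX z1 expr1n.
set x := z ^+ 2 in x1 *; set d := nsq (1 - x).
pose e := (1 - x) + (1 - w) ^+ 2 * x.
pose o := (2 * w - 1) * (1 - x) - (1 - w) ^+ 2 * x.
have -> : nsq (1 - z) * nsq (1 + w * z) ^+ 2 + nsq (1 - - z) * nsq (1 - w * z) ^+ 2
    = 2 * (nsq e + nsq o).
  have -> : nsq o = nsq (z * o) by rewrite nsqM z1 mul1r.
  rewrite -parallelogram -!nsqX -!nsqM; congr (nsq _ + nsq _); rewrite /e /o /x; ring.
have n2w : nsq (2 * w - 1) = 1 + 2 * eps.
  by move: w1; rewrite /eps; case: (w) => a b; rewrite /nsq /=; lra.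
(* With this constant [(4/3) (2 + 2 eps) <= 4] when [eps <= 1/2]. *)
have k0 : 0 < 3^-1 :> R by lra.
have he : nsq e <= (1 + 3^-1) * d + 4 * eps ^+ 2.
  apply: (le_trans (nsqD_le _ _ k0)).
  by rewrite invrK (nsqM _ x) nsqX x1 -/eps -/d mulr1; lra.
have ho : nsq o <= (1 + 3^-1) * ((1 + 2 * eps) * d) + 4 * eps ^+ 2.
  apply: (le_trans (nsqD_le _ _ k0)).
  by rewrite invrK nsqN (nsqM _ x) (nsqM _ (1 - x)) nsqX x1 n2w -/eps -/d; lra.
have d0 : 0 <= d := nsq_ge0 _.
have e0 : 0 <= eps := nsq_ge0 _.
by nra.
Qed.

Lemma weighted_energy_const (c : R) n K xi :
  weighted_energy w n (fun=> c) K xi = c * weighted_energy w n (fun=> 1) K xi.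
Proof. by rewrite /weighted_energy mulr_sumr; apply: eq_bigr => j _; rewrite mulrA mulr1. Qed.

Let lam := 1 - eps / 32.

(** Each two steps multiply the normalised energy by at most
    [1 - eps / 16 <= lam ^+ 2].  For odd [n] the first step may gain nothing;
    the factor 8/7 pays for it, since [lam >= 7/8]. *)
Lemma energy_bound n xi : (2 ^ n.+2).-primitive_root xi ->
  weighted_energy w n (fun=> 1) (2 ^ n.+2) xi <= 4 * 16 ^+ n * (8 / 7 * lam ^+ n).
Proof.
have e0 : 0 <= eps := nsq_ge0 _; have e4 : eps <= 4 := nsqB1_le4 w1.
have m1 k zeta : (2 ^ k.+3).-primitive_root zeta ->
  weighted_energy w k.+1 (fun=> 1) (2 ^ k.+3) zeta
    <= 2 * weighted_energy w k (fun z => 8 - nsq (1 - w ^+ 2 * z)) (2 ^ k.+2) (zeta ^+ 2).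
  rewrite (expnS 2 k.+2) => zP; apply: weighted_energy_step => // z z1.
  by rewrite !mul1r energy_step.
pose P n := forall xi, (2 ^ n.+2).-primitive_root xi ->
  weighted_energy w n (fun=> 1) (2 ^ n.+2) xi <= 4 * 16 ^+ n * (8 / 7 * lam ^+ n).
have E0 zeta : weighted_energy w 0 (fun=> 1) (2 ^ 2) zeta = 4.
  rewrite /weighted_energy (eq_bigr (fun=> 1)) => [|j _]; last by rewrite riesz0 nsq1 expr1n mulr1.
  by rewrite sumr_const card_ord.
have P0 : P 0%N by move=> zeta _; rewrite E0 !expr0; lra.
suff Pn : forall k, P k /\ P k.+1 by exact: (Pn n).1.
elim=> [|k [IHk IHk1]]; split=> //.
  move=> zeta zP; apply: (le_trans (m1 _ _ zP)).
  have zP' := zP; rewrite (expnS 2 2) in zP'; have [z2P _] := prim_root_half zP'.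
  have h : weighted_energy w 0 (fun z => 8 - nsq (1 - w ^+ 2 * z)) (2 ^ 2) (zeta ^+ 2)
      <= weighted_energy w 0 (fun=> 8) (2 ^ 2) (zeta ^+ 2).
    by apply: (ler_weighted_energy _ _ z2P) => z _; have := nsq_ge0 (1 - w ^+ 2 * z); lra.
  by move: h; rewrite (weighted_energy_const 8) E0 /lam !expr1; lra.
move=> zeta zP; apply: (le_trans (m1 _ _ zP)).
have zP' := zP; rewrite (expnS 2 k.+3) in zP'; have [z2P _] := prim_root_half zP'.
have z2P' := z2P; rewrite (expnS 2 k.+2) in z2P'; have [z4P _] := prim_root_half z2P'.
have h : weighted_energy w k.+1 (fun z => 8 - nsq (1 - w ^+ 2 * z)) (2 ^ k.+3) (zeta ^+ 2)
   <= 2 * weighted_energy w k (fun=> 64 - 4 * eps) (2 ^ k.+2) (zeta ^+ 2 ^+ 2).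
  rewrite (expnS 2 k.+2); apply: (weighted_energy_step _ z2P') => z z1.
  exact: energy_two_steps.
move: h; rewrite (weighted_energy_const (64 - 4 * eps)) => h.
have {}IHk := IHk _ z4P; apply: (le_trans (ler_wpM2l _ h)) => //.
set m := weighted_energy _ _ _ _ _ in IHk *.
have -> : 4 * 16 ^+ k.+2 * (8 / 7 * lam ^+ k.+2)
    = 256 * lam ^+ 2 * (4 * 16 ^+ k * (8 / 7 * lam ^+ k)).
  by rewrite -!(addn2 k) !exprD; move: (16 ^+ k) (lam ^+ k) => a b; ring.
have p256 : 0 <= 256 :> R by rewrite ler0n.
apply: (@le_trans _ _ (256 * lam ^+ 2 * m)).
  have m0 : 0 <= m by apply: sumr_ge0 => j _; rewrite mul1r sqr_ge0.
  have -> : 2 * (2 * ((64 - 4 * eps) * m)) = (256 * (1 - eps / 16)) * m by field.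
  by rewrite (ler_wpM2r m0) // (ler_wpM2l p256) // /lam; have := sqr_ge0 eps; lra.
by rewrite (ler_wpM2l (mulr_ge0 p256 (sqr_ge0 lam))).
Qed.

(** After division by [16 ^+ n] one step reads [D' <= D / 2 + eps^2 E], where [E]
    decays like [lam ^+ n]: the initial value of [D] dies geometrically and the
    source term [eps^2 E] survives.  The step needs [eps <= 1/2]; for larger [eps]
    the factor [eps^2] is bounded below and [|1 - z|^2 <= 4] is enough. *)
Lemma difference_energy_bound n xi : (2 ^ n.+2).-primitive_root xi ->
  weighted_energy w n (fun z => nsq (1 - z)) (2 ^ n.+2) xi
  <= 4 * 16 ^+ n * (20 * eps ^+ 2 * lam ^+ n + 2 * 2^-1 ^+ n).
Proof.
have e0 : 0 <= eps := nsq_ge0 _; have e4 : eps <= 4 := nsqB1_le4 w1.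
have lam0 : 0 <= lam by rewrite /lam; lra.
have [esmall|ebig] := leP eps (1 / 2); last first.
  move=> xiP; apply: (@le_trans _ _ (weighted_energy w n (fun=> 4) (2 ^ n.+2) xi)).
    by apply: (ler_weighted_energy _ _ xiP) => z; apply: nsqB1_le4.
  rewrite weighted_energy_const; have := energy_bound xiP.
  set m := weighted_energy _ _ _ _ _ => mle.
  have l0 : 0 <= lam ^+ n by rewrite exprn_ge0.
  have h0 : 0 <= 2^-1 ^+ n :> R by rewrite exprn_ge0 // invr_ge0.
  apply: (le_trans (ler_wpM2l _ mle)) => //; rewrite mulrCA ler_wpM2l ?mulr_ge0 ?exprn_ge0 //.
  have h : 1/4 * lam ^+ n <= eps ^+ 2 * lam ^+ n by rewrite ler_wpM2r //; nra.
  by lra.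
elim: n xi => [|n IH] xi xiP.
  rewrite /weighted_energy (eq_bigr (fun j => nsq (1 - xi ^+ nat_of_ord j))) => [|j _]; last first.
    by rewrite riesz0 nsq1 expr1n mulr1.
  suff -> : \sum_(j < 2 ^ 2) nsq (1 - xi ^+ j) = 8 by rewrite !expr0; have := sqr_ge0 eps; lra.
  have [_ x2] := @prim_root_half 2 xi xiP.
  have x3 : xi ^+ 3 = - xi by rewrite exprSr x2 mulN1r.
  rewrite !big_ord_recl big_ord0 /= /bump /= expr0 expr1 x2 x3 subrr nsq0.
  have := parallelogram 1 xi; rewrite !opprK nsq1 (nsq_prim_root xiP).
  have -> : nsq (1 + 1 : R[i]) = 4 by rewrite /nsq /=; ring.
  by lra.
have xiP' := xiP; rewrite (expnS 2 n.+2) in xiP'; have [x2P _] := prim_root_half xiP'.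
have h : weighted_energy w n.+1 (fun z => nsq (1 - z)) (2 ^ n.+3) xi
   <= 2 * weighted_energy w n (fun z => 4 * nsq (1 - z) + 8 * eps ^+ 2) (2 ^ n.+2) (xi ^+ 2).
  by rewrite (expnS 2 n.+2); apply: (weighted_energy_step _ xiP') => z z1;
     apply: difference_energy_step.
apply: (le_trans h).
have -> : weighted_energy w n (fun z => 4 * nsq (1 - z) + 8 * eps ^+ 2) (2 ^ n.+2) (xi ^+ 2)
  = 4 * weighted_energy w n (fun z => nsq (1 - z)) (2 ^ n.+2) (xi ^+ 2)
    + 8 * eps ^+ 2 * weighted_energy w n (fun=> 1) (2 ^ n.+2) (xi ^+ 2).
  rewrite /weighted_energy !mulr_sumr -big_split /=; apply: eq_bigr => j _; ring.
have := IH _ x2P; have := energy_bound x2P.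
set E := weighted_energy _ _ _ _ _; set D := weighted_energy _ _ _ _ _ => hE hD.
rewrite !exprS.
have c0 : 0 <= 16 ^+ n :> R by rewrite exprn_ge0.
have l0 : 0 <= lam ^+ n by rewrite exprn_ge0.
move: (16 ^+ n) (lam ^+ n) (2^-1 ^+ n) c0 l0 hE hD => c l k c0 l0 hE hD.
have ee : 0 <= eps ^+ 2 := sqr_ge0 _.
have hE' := ler_wpM2l ee hE.
have t0 : 0 <= c * l * eps ^+ 2 by rewrite !mulr_ge0.
have hl : 31 / 32 * (c * l * eps ^+ 2) <= lam * (c * l * eps ^+ 2).
  by rewrite ler_wpM2r // /lam; lra.
lra.
Qed.

End Riesz.

(** * Riesz products at the roots of unity of Mersenne order *)

Section MersenneRoots.
Variable R : rcfType.
Implicit Types w z : R[i].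

Definition difference_poly w n : {poly R[i]} :=
  (1 - 'X) * (\prod_(i < n) (1 + w *: 'X^(2 ^ i))) ^+ 2.

Lemma horner_difference_poly w n z : (difference_poly w n).[z] = (1 - z) * riesz w n z ^+ 2.
Proof.
rewrite /difference_poly hornerM horner_exp horner_prod.
have -> : \prod_(i < n) (1 + w *: 'X^(2 ^ i)).[z] = riesz w n z.
  by apply: eq_bigr => i _; rewrite !hornerE.
by rewrite !hornerE.
Qed.

Lemma size_difference_poly w n : (size (difference_poly w n) <= 2 ^ n.+1)%N.
Proof.
rewrite /difference_poly; set P := \prod_(i < n) _.
have sP : (size P <= 2 ^ n)%N.
  rewrite /P; elim: n {P} => [|n IH]; first by rewrite big_ord0 size_poly1.
  rewrite big_ord_recr /=; apply: leq_trans (size_polyMleq _ _) _.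
  have s1 : (size (1 + w *: 'X^(2 ^ n) : {poly R[i]})%R <= (2 ^ n).+1)%N.
    apply: leq_trans (size_polyD _ _) _; rewrite geq_max size_poly1 /=.
    by apply: leq_trans (size_scale_leq _ _) _; rewrite size_polyXn.
  by rewrite -subn1 leq_subLR add1n (leq_trans (leq_add IH s1)) // expnS mul2n -addnn addnS.
have s2 : (size (1 - 'X : {poly R[i]})%R <= 2)%N.
  by rewrite -opprB size_polyN size_XsubC.
apply: leq_trans (size_polyMleq _ _) _; rewrite -subn1 leq_subLR add1n expnS.
have sPP : (size (P ^+ 2) <= (2 ^ n + 2 ^ n).-1)%N.
  by apply: leq_trans (size_polyMleq P P) _; rewrite -!subn1 leq_sub2r // leq_add.
apply: leq_trans (leq_add s2 sPP) _.
by have : (0 < 2 ^ n)%N by [rewrite expn_gt0]; lia.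
Qed.

Lemma nsq_difference_poly w n z :
  nsq (difference_poly w n).[z] = nsq (1 - z) * nsq (riesz w n z) ^+ 2.
Proof. by rewrite horner_difference_poly nsqM nsqX. Qed.

Lemma sum_every_third (F : nat -> R) N : (forall j, 0 <= F j) ->
  \sum_(t < N) F (3 * t)%N <= \sum_(j < 3 * N) F j.
Proof.
move=> F0; elim: N => [|N IH]; first by rewrite muln0 !big_ord0.
rewrite mulnS addnC !addnS addn0 !big_ord_recr /=.
by have := F0 (3 * N).+1; have := F0 (3 * N).+2; lra.
Qed.

(** Squaring permutes the roots of unity of odd order [N = 2 ^ n - 1], so the
    recursion of the preceding section does not apply to them.  They are contained
    in the roots of order [3 N]; the polynomial has degree at most [2 N + 1 < 3 N],
    so by Parseval its mean over these is its mean over the roots of order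
    [2 ^ n.+2], where the recursion applies. *)
Lemma mersenne_difference_energy w n y : nsq w = 1 -> (2 <= n)%N ->
  (3 * (2 ^ n - 1)).-primitive_root y ->
  weighted_energy w n (fun z => nsq (1 - z)) (2 ^ n - 1) (y ^+ 3) <=
  3 * 16 ^+ n * (20 * nsq (1 - w) ^+ 2 * (1 - nsq (1 - w) / 32) ^+ n + 2 * 2^-1 ^+ n).
Proof.
move=> w1 n2; set N := (2 ^ n - 1)%N => yP.
have N1 : (4 <= 2 ^ n)%N by rewrite (@leq_pexp2l 2 2).
pose F z := nsq (1 - z) * nsq (riesz w n z) ^+ 2.
have F0 z : 0 <= F z by rewrite mulr_ge0 ?sqr_ge0 ?nsq_ge0.
pose S := \sum_(k < size (difference_poly w n)) nsq (difference_poly w n)`_k.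
have sq : (size (difference_poly w n) <= 2 ^ n.+1)%N := size_difference_poly w n.
have le3 : weighted_energy w n (fun z => nsq (1 - z)) N (y ^+ 3) <= (3 * N)%:R * S.
  rewrite -(parseval_poly yP); last by apply: leq_trans sq _; rewrite expnS /N; lia.
  under [leRHS]eq_bigr do rewrite nsq_difference_poly.
  apply: le_trans (sum_every_third N (fun j => F0 (y ^+ j))).
  by rewrite /weighted_energy le_eqVlt; apply/orP; left; apply/eqP;
     apply: eq_bigr => j _; rewrite exprM.
have [x xP] : exists x : R[i], (2 ^ n.+2).-primitive_root x.
  by apply: complex_prim_root_exists; rewrite expn_gt0.
have := difference_energy_bound w1 xP.
have -> : weighted_energy w n (fun z => nsq (1 - z)) (2 ^ n.+2) x = (2 ^ n.+2)%:R * S.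
  rewrite -(parseval_poly xP); last by apply: leq_trans sq _; rewrite leq_exp2l.
  by apply: eq_bigr => j _; rewrite nsq_difference_poly.
set B := (_ + _ : R) => hS; apply: (le_trans le3).
have S0 : 0 <= S by apply: sumr_ge0 => k _; apply: nsq_ge0.
have : (3 * N)%:R * S <= 3 / 4 * ((2 ^ n.+2)%:R * S).
  rewrite mulrA ler_wpM2r // mulrAC ler_pdivlMr // -!natrM ler_nat !expnS /N; lia.
by lra.
Qed.

(** On a cycle of length [n] of the doubling map, squaring permutes the factors
    cyclically. *)
Lemma riesz_sqr w n z : z ^+ (2 ^ n) = z -> riesz w n (z ^+ 2) = riesz w n z.
Proof.
case: n => [|n] zn; first by rewrite !riesz0.
rewrite [RHS]rieszS [LHS]big_ord_recr /= -exprM -expnS zn mulrC; congr (_ * _).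
Qed.

Lemma riesz_sqr_iter w n z i : z ^+ (2 ^ n) = z -> riesz w n (z ^+ (2 ^ i)) = riesz w n z.
Proof.
move=> zn; elim: i => [|i IH]; first by rewrite expr1.
rewrite expnSr exprM riesz_sqr // -exprM mulnC exprM zn //.
Qed.

(** As long as [|1 - z|^2 < 1], squaring multiplies [|1 - z|^2] by at least 3;
    a periodic point other than 1 cannot stay that close to 1. *)
Lemma doubling_orbit_escapes n z : (0 < n)%N -> nsq z = 1 -> z ^+ (2 ^ n) = z -> z != 1 ->
  1 <= \sum_(i < n) nsq (1 - z ^+ (2 ^ i)).
Proof.
move=> n0 z1 zn zn1; rewrite leNgt; apply/negP => small.
pose x i := nsq (1 - z ^+ (2 ^ i)).
have x_small i : (i < n)%N -> x i < 1.
  move=> i_n; apply: le_lt_trans small; rewrite (bigD1 (Ordinal i_n)) //= -/(x i).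
  by rewrite lerDl sumr_ge0 // => j _; apply: nsq_ge0.
have xS i : x i.+1 = x i * (4 - x i).
  by rewrite /x expnSr exprM nsqB1_double // nsqX z1 expr1n.
have x0 : 0 < x 0%N.
  rewrite lt_neqAle nsq_ge0 andbT /x expr1; apply: contra zn1 => /eqP/esym.
  move/(congr1 (real_complex R)) => /eqP; rewrite nsq_conj mulf_eq0 conjc_eq0 orbb.
  by rewrite subr_eq0 eq_sym.
have grow i : (i < n)%N -> 3 * x 0%N <= x i.+1.
  elim: i => [|i IH] i_n; first by rewrite xS; have := x_small _ i_n; nra.
  by have := IH (ltnW i_n); rewrite [x i.+2]xS; have := x_small _ i_n; nra.
have := grow n.-1; rewrite prednK // => /(_ (leqnn _)).
by rewrite {2}/x zn -[z]expr1 -/(x 0%N); lra.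
Qed.

(** The condition [t != 0] is traded for a weight that vanishes at [t = 0]: every
    other [t] is counted by one of the [n] weights [|1 - zeta^(2^i t)|^2], and by
    cyclic invariance of the Riesz product each of these leads to the same kind of
    sum, for the primitive root [zeta^(2^i)] in place of [zeta]. *)
Lemma riesz_nontrivial_sum w n y : nsq w = 1 -> (2 <= n)%N ->
  (3 * (2 ^ n - 1)).-primitive_root y ->
  \sum_(t < 2 ^ n - 1 | t != 0%N :> nat) nsq (riesz w n (y ^+ 3 ^+ t)) ^+ 2 <=
  n%:R * (3 * 16 ^+ n *
    (20 * nsq (1 - w) ^+ 2 * (1 - nsq (1 - w) / 32) ^+ n + 2 * 2^-1 ^+ n)).
Proof.
move=> w1 n2 yP; set B := 3 * _ * _.
have zP : (2 ^ n - 1).-primitive_root (y ^+ 3).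
  have := dvdn_prim_root yP (dvdn_mull 3 (dvdnn (2 ^ n - 1))).
  by rewrite mulnK // subn_gt0 -{1}(expn0 2) ltn_exp2l // ltnW.
have zn t : (y ^+ 3 ^+ t) ^+ (2 ^ n) = y ^+ 3 ^+ t.
  have -> : (2 ^ n = (2 ^ n - 1).+1)%N by rewrite subn1 prednK ?expn_gt0.
  by rewrite exprS [_ ^+ t ^+ _]exprAC (prim_expr_order zP) expr1n mulr1.
apply: (@le_trans _ _ (\sum_(i < n) weighted_energy w n (fun z => nsq (1 - z)) (2 ^ n - 1)
    ((y ^+ (2 ^ i)) ^+ 3))).
  rewrite /weighted_energy exchange_big /= big_mkcond /=; apply: ler_sum => t _.
  set P := nsq (riesz _ _ (y ^+ 3 ^+ t)) ^+ 2.
  have -> : \sum_(i < n) nsq (1 - (y ^+ (2 ^ i)) ^+ 3 ^+ t) *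
     nsq (riesz w n ((y ^+ (2 ^ i)) ^+ 3 ^+ t)) ^+ 2 =
     (\sum_(i < n) nsq (1 - (y ^+ 3 ^+ t) ^+ (2 ^ i))) * P.
    rewrite mulr_suml; apply: eq_bigr => i _.
    have -> : (y ^+ (2 ^ i)) ^+ 3 ^+ t = (y ^+ 3 ^+ t) ^+ (2 ^ i).
      by rewrite -!exprM; congr (_ ^+ _); lia.
    by rewrite riesz_sqr_iter.
  have P0 : 0 <= P := sqr_ge0 _.
  case: eqP => [_|/eqP t0] /=.
    by rewrite mulr_ge0 // sumr_ge0 // => i _; apply: nsq_ge0.
  rewrite -[leLHS]mul1r ler_wpM2r //; apply: doubling_orbit_escapes => //.
  - exact: ltnW.
  - by rewrite -exprM (nsq_prim_rootX _ yP).
  - by rewrite -(prim_order_dvd zP) gtnNdvd ?lt0n.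
apply: (@le_trans _ _ (\sum_(i < n) B)); last by rewrite sumr_const card_ord mulr_natl.
apply: ler_sum => i _; apply: mersenne_difference_energy => //.
rewrite (prim_root_exp_coprime _ yP) coprimeXl // coprime2n oddM oddB ?expn_gt0 // oddX.
by case: n n2 {yP B zP zn i}.
Qed.

End MersenneRoots.

(** * Binary digit sums and the layers *)

Section Digits.

(** The formula that defines [wt], on all integers: splitting off the lowest digit
    leaves the residues modulo [2 ^ n - 1]. *)
Definition digit_sum n x : nat := \sum_(i < n) odd (x %/ 2 ^ i).

Lemma digit_sumS n (b : bool) x : digit_sum n.+1 (b + 2 * x) = (b + digit_sum n x)%N.
Proof.
rewrite /digit_sum big_ord_recl /= divn1 oddD oddM /= addbF oddb; congr (_ + _)%N.
apply: eq_bigr => i _; rewrite /bump /= add1n expnS divnMA; congr (nat_of_bool (odd (_ %/ _))).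
by rewrite addnC mulnC divnMDl // [(b %/ 2)%N]divn_small ?addn0 //; case: b.
Qed.

Lemma digit_sum_le n x : (digit_sum n x <= n)%N.
Proof.
by rewrite -[leqRHS]card_ord -sum1_card leq_sum // => i _; apply: leq_b1.
Qed.

Lemma sum_binary (V : zmodType) (F : nat -> V) n :
  \sum_(x < 2 ^ n.+1) F x = \sum_(x < 2 ^ n) (F (2 * x)%N + F (1 + 2 * x)%N).
Proof.
rewrite expnS -(big_mkord xpredT F) -(big_mkord xpredT (fun x => F (2 * x)%N + F (1 + 2 * x)%N)).
rewrite mulnC big_nat_mul; apply: eq_bigr => x _.
by rewrite mulSn addnC addn2 big_nat_recr ?leqnSn // big_nat1 mulnC add1n.
Qed.

Lemma digit_sum_full n : digit_sum n (2 ^ n - 1) = n.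
Proof.
elim: n => [|n IH]; first by rewrite /digit_sum big_ord0.
have -> : (2 ^ n.+1 - 1 = true + 2 * (2 ^ n - 1))%N.
  by rewrite expnS; have : (0 < 2 ^ n)%N by [rewrite expn_gt0]; lia.
by rewrite digit_sumS IH.
Qed.

Lemma digit_sum_onto n d : (d <= n)%N -> exists2 x, (x < 2 ^ n)%N & digit_sum n x = d.
Proof.
elim: n d => [|n IH] d.
  by rewrite leqn0 => /eqP->; exists 0%N; rewrite // /digit_sum big_ord0.
case: d => [_|d dn].
  have [x xn xd] := IH 0%N (leq0n n); exists (false + 2 * x)%N; last by rewrite digit_sumS xd.
  by rewrite expnS; lia.
have [x xn xd] := IH d dn; exists (true + 2 * x)%N; last by rewrite digit_sumS xd.
by rewrite expnS; lia.
Qed.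

End Digits.

Section Layers.
Variable R : rcfType.
Implicit Types w z : R[i].

Lemma riesz_digit_sum w z n :
  riesz w n z = \sum_(x < 2 ^ n) w ^+ digit_sum n x * z ^+ x.
Proof.
elim: n z => [|n IH] z.
  by rewrite riesz0 big_ord_recl big_ord0 /digit_sum big_ord0 mul1r addr0.
rewrite rieszS IH (sum_binary (fun x => w ^+ digit_sum n.+1 x * z ^+ x)) mulr_sumr.
apply: eq_bigr => x _.
have -> : digit_sum n.+1 (1 + 2 * x) = (1 + digit_sum n x)%N := digit_sumS n true x.
have -> : digit_sum n.+1 (2 * x) = digit_sum n x := digit_sumS n false x.
by rewrite (exprD w 1) (exprD z 1) (exprM z 2) !expr1; ring.
Qed.

Definition layer_sum n d z : R[i] := \sum_(x < 2 ^ n | digit_sum n x == d) z ^+ x.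

(** Orthogonality of the characters of Z/MZ extracts the terms with digit sum [d];
    no other digit sum is congruent to [d] because all of them are less than [M]. *)
Lemma layer_sum_riesz n d M e z : M.-primitive_root e -> (d <= n)%N -> (n < M)%N ->
  M%:R * layer_sum n d z = \sum_(s < M) conjc (e ^+ (s * d)) * riesz (e ^+ s) n z.
Proof.
move=> eP dn nM.
under eq_bigr do rewrite riesz_digit_sum mulr_sumr.
rewrite exchange_big /= /layer_sum mulr_sumr big_mkcond /=; apply: eq_bigr => x _.
have xM : (digit_sum n x < M)%N := leq_ltn_trans (digit_sum_le n x) nM.
have dM : (d < M)%N := leq_ltn_trans dn nM.
transitivity (\sum_(s < M) e ^+ (s * Ordinal xM) * conjc (e ^+ (s * Ordinal dM)) * z ^+ x).
  rewrite -mulr_suml (prim_root_ortho _ _ eP) -val_eqE /=.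
  by case: ifP; rewrite ?mul0r.
by apply: eq_bigr => s _ /=; rewrite [e ^+ (s * digit_sum n x)]exprM; ring.
Qed.

End Layers.

(** * Poisson kernel weights *)

Section PoissonWeights.
Variable R : rcfType.

Lemma bernoulli_decay (x : R) n : 0 <= x -> x <= 1 -> (1 - x) ^+ n * (1 + n%:R * x) <= 1.
Proof.
move=> x0 x1; elim: n => [|n IH]; first by rewrite expr0; lra.
apply: le_trans IH; rewrite exprSr -mulrA ler_wpM2l ?exprn_ge0 ?subr_ge0 //.
have : 0 <= n%:R :> R by []; rewrite -natr1; move: (n%:R : R) => k k0.
have : 0 <= k * x ^+ 2 by rewrite mulr_ge0 ?sqr_ge0.
have := sqr_ge0 x; lra.
Qed.

(** With [r = 1 - 1/m] this is [(1 - r)^2 / |1 - r e|^2], the Poisson kernel up to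
    normalisation: close to 1 where [|1 - e| <= 1/m], and decaying like
    [(m |1 - e|)^-2] beyond. *)
Definition poisson m (e : R[i]) : R := (1 + m%:R * (m%:R - 1) * nsq (1 - e))^-1.

Lemma poisson_gt0 m e : (0 < m)%N -> 0 < poisson m e.
Proof.
move=> m0; have m1 : 1 <= m%:R :> R by rewrite ler1n.
have : 0 <= m%:R * (m%:R - 1) * nsq (1 - e) by rewrite !mulr_ge0 ?nsq_ge0 ?subr_ge0.
by rewrite /poisson invr_gt0; lra.
Qed.

(** On roots of unity of order [M = m ^ 2], [1 / (1 - r z)] equals the polynomial
    with coefficients [r ^+ k], [k < M], divided by [1 - r ^+ M].  Parseval
    evaluates the sum of its squared moduli, so no estimate of trigonometric
    functions is needed. *)
Lemma poisson_total m (e : R[i]) : (2 <= m)%N -> (m ^ 2).-primitive_root e ->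
  \sum_(s < m ^ 2) poisson m (e ^+ s) <= 2 * m%:R.
Proof.
move=> m2; set M := (m ^ 2)%N => eP.
have mR : 2 <= m%:R :> R by rewrite (ler_nat R 2 m).
have [r rE] : exists r : R, r = 1 - m%:R^-1 by exists (1 - m%:R^-1).
have im0 : 0 < m%:R^-1 :> R by rewrite invr_gt0; lra.
have im1 : m%:R^-1 <= 2^-1 :> R by rewrite lef_pV2 ?posrE; lra.
have mV : m%:R * m%:R^-1 = 1 :> R by rewrite mulfV //; lra.
have r0 : 0 <= r by rewrite rE; lra.
have rm : r ^+ m <= 1 / 2.
  have := @bernoulli_decay m%:R^-1 m (ltW im0); rewrite -rE mV => h.
  by have := h ltac:(lra); lra.
have rM : r ^+ M <= 1 / 2.
  apply: le_trans rm; rewrite /M expnSr expn1 exprM -[leRHS]expr1.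
  apply: ler_wiXn2l => //; first exact: exprn_ge0.
    by rewrite exprn_ile1 // rE; lra.
  by lia.
pose q (z : R[i]) : R[i] := \sum_(k < M) (r ^+ k)%:C%C * z ^+ k.
have qE s : poisson m (e ^+ s) = nsq (q (e ^+ s)) / (m%:R * (1 - r ^+ M)) ^+ 2.
  set z := e ^+ s; have z1 : nsq z = 1 := nsq_prim_rootX s eP.
  have zM : z ^+ M = 1 by rewrite exprAC (prim_expr_order eP) expr1n.
  have geo : (1 - r%:C%C * z) * q z = (1 - r ^+ M)%:C%C.
    have -> : q z = \sum_(k < M) (r%:C%C * z) ^+ k.
      by apply: eq_bigr => k _; rewrite exprMn (rmorphXn (real_complex R)).
    rewrite -opprB mulNr -subrX1 opprB exprMn zM mulr1 (rmorphB (real_complex R)).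
    by rewrite (rmorphXn (real_complex R)) rmorph1.
  have n1 : nsq (1 - r%:C%C * z) = (poisson m z)^-1 / m%:R ^+ 2.
    rewrite /poisson invrK.
    have -> : nsq (1 - r%:C%C * z) = (1 - r) ^+ 2 + r * nsq (1 - z).
      by move: z1; case: (z) => a b; rewrite /nsq /= => h; nra.
    by rewrite rE; field; lra.
  have := congr1 (@nsq R) geo; rewrite nsqM n1 nsqR => h.
  have p0 := @poisson_gt0 m z ltac:(lia).
  have Q0 : nsq (q z) != 0.
    by apply/negP => /eqP q0; move: h; rewrite q0 mulr0 => /esym/eqP; rewrite sqrf_eq0; lra.
  have m0 : m%:R != 0 :> R by lra.
  rewrite exprMn -h; move: (poisson m z) (nsq (q z)) p0 Q0 => p Q p0 Q0.
  by field; rewrite m0 Q0 gt_eqF.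
under eq_bigr do rewrite qE.
rewrite -mulr_suml.
have -> : \sum_(s < M) nsq (q (e ^+ s)) = M%:R * \sum_(k < M) (r ^+ k) ^+ 2.
  rewrite (eq_bigr (fun s : 'I_M => nsq (\sum_(k < M) (r ^+ k)%:C%C * e ^+ (s * k)))).
    by rewrite (parseval _ eP); congr (_ * _); apply: eq_bigr => k _; rewrite nsqR.
  by move=> s _; congr nsq; apply: eq_bigr => k _; rewrite exprM.
have S : \sum_(k < M) (r ^+ k) ^+ 2 <= m%:R * (1 - r ^+ M).
  apply: (@le_trans _ _ (\sum_(k < M) r ^+ k)).
    apply: ler_sum => k _; rewrite -[leRHS]expr1; apply: ler_wiXn2l => //; first exact: exprn_ge0.
    by rewrite exprn_ile1 // rE; lra.
  have := subrX1 r M; set T := \sum_(k < M) _ => h.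
  have -> : 1 - r ^+ M = m%:R^-1 * T by rewrite -opprB h rE; ring.
  by rewrite mulrA mV mul1r.
have MR : M%:R = m%:R ^+ 2 :> R by rewrite /M natrX.
have d0 : 0 < 1 - r ^+ M by lra.
rewrite ler_pdivrMr ?exprn_gt0 ?mulr_gt0 //; last by lra.
rewrite MR exprMn; set d := 1 - _ in S d0 *.
have m20 : 0 < m%:R ^+ 2 :> R by rewrite exprn_gt0; lra.
have -> : 2 * m%:R * (m%:R ^+ 2 * d ^+ 2) = m%:R ^+ 2 * (2 * m%:R * d ^+ 2) by ring.
rewrite ler_wpM2l ?(ltW m20) //; apply: (le_trans S).
have : 1 / 2 <= d by rewrite /d; lra.
have : 0 <= m%:R * d by rewrite mulr_ge0 //; lra.
by move=> h1 h2; nra.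
Qed.

End PoissonWeights.

(** * The fourth moment of the Fourier transform of a layer *)

Section FourthMoment.
Variable R : rcfType.

(** Six is the number of powers of [n eps] that [weighted_decay] has to absorb;
    [192 = 6 * 32]. *)
Lemma sixth_power_decay (e : R) n : 0 <= e -> e <= 32 ->
  (1 - e / 32) ^+ n * (1 + n%:R * (e / 192)) ^+ 6 <= 1.
Proof.
move=> e0 e32; set x := e / 192.
have x0 : 0 <= x by rewrite /x; lra.
have x1 : x <= 1 / 6 by rewrite /x; lra.
have ex : 1 - e / 32 <= (1 - x) ^+ 6.
  rewrite -subr_ge0.
  have -> : (1 - x) ^+ 6 - (1 - e / 32) =
      x ^+ 2 * (5 * (3 - 4 * x) + x ^+ 2 * (3 * (5 - 2 * x) + x ^+ 2)).
    by rewrite /x; field.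
  have xx0 : 0 <= x ^+ 2 by apply: sqr_ge0.
  by have := mulr_ge0 xx0 xx0; have := mulr_ge0 xx0 x0; nra.
have y0 : 0 <= 1 + n%:R * x by rewrite addr_ge0 // mulr_ge0.
apply: (@le_trans _ _ (((1 - x) ^+ n * (1 + n%:R * x)) ^+ 6)).
  rewrite exprMn -exprM mulnC exprM ler_wpM2r ?(exprn_ge0 _ y0) //.
  by apply: lerXn2r => //; rewrite nnegrE ?exprn_ge0 //; lra.
apply: exprn_ile1; last by apply: bernoulli_decay => //; lra.
by rewrite mulr_ge0 ?exprn_ge0 //; lra.
Qed.

Definition decay_const : R := 20 * (192 ^+ 2 * 768 ^+ 4) + 2 * (12 ^+ 2 * 192 ^+ 4).

Lemma decay_const_gt0 : 0 < decay_const.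
Proof.
have pos j k : (0 < j)%N -> (0 < k)%N -> 0 < j%:R ^+ 2 * k%:R ^+ 4 :> R.
  by move=> j0 k0; rewrite mulr_gt0 // exprn_gt0 // ltr0n.
by rewrite /decay_const; have := pos 192 768 isT isT; have := pos 12 192 isT isT; lra.
Qed.

(** Both [n e] and [1 + a e] are at most multiples of [1 + n e / 192], so the factor
    in front of [e^2 (1 - e/32)^n] costs at most its sixth power; likewise the
    factor in front of [2^-n], which is the case [e = 16] of the decay, costs a
    sixth power of [1 + n / 12]. *)
Lemma weighted_decay (e a : R) n : (0 < n)%N -> 0 <= e -> e <= 4 -> 0 <= a -> a <= 4 * n%:R ->
  n%:R ^+ 2 * (1 + a * e) ^+ 4 * (20 * e ^+ 2 * (1 - e / 32) ^+ n + 2 * 2^-1 ^+ n)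
  <= decay_const.
Proof.
move=> n0 e0 e4 a0 an; have n1 : 1 <= n%:R :> R by rewrite ler1n.
have bound (c : R) k1 k2 x L : 0 <= L -> 0 <= c -> L * c ^+ 6 <= 1 ->
    0 <= k1 -> 0 <= k2 -> 0 <= x -> x <= k1 * c -> 1 + a * e <= k2 * c ->
    x ^+ 2 * (1 + a * e) ^+ 4 * L <= k1 ^+ 2 * k2 ^+ 4.
  move=> L0 c0 Lc k10 k20 x0 xk ak.
  have ae0 : 0 <= 1 + a * e by rewrite addr_ge0 ?mulr_ge0.
  apply: (@le_trans _ _ ((k1 * c) ^+ 2 * (k2 * c) ^+ 4 * L)).
    rewrite ler_wpM2r // ler_pM ?exprn_ge0 //; apply: lerXn2r;
      by rewrite ?nnegrE ?mulr_ge0.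
  have -> : (k1 * c) ^+ 2 * (k2 * c) ^+ 4 * L = k1 ^+ 2 * k2 ^+ 4 * (L * c ^+ 6) by ring.
  by rewrite ler_piMr // mulr_ge0 ?exprn_ge0.
have ae : a * e <= 4 * n%:R * e by rewrite ler_wpM2r.
have ne0 : 0 <= n%:R * e by rewrite mulr_ge0.
have main : (n%:R * e) ^+ 2 * (1 + a * e) ^+ 4 * (1 - e / 32) ^+ n <= 192 ^+ 2 * 768 ^+ 4.
  apply: (bound (1 + n%:R * (e / 192))); try lra.
    by rewrite exprn_ge0 //; lra.
  by apply: sixth_power_decay => //; lra.
have half : n%:R ^+ 2 * (1 + a * e) ^+ 4 * 2^-1 ^+ n <= 12 ^+ 2 * 192 ^+ 4.
  apply: (bound (1 + n%:R * (16 / 192))); try lra.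
  - by rewrite exprn_ge0 // invr_ge0.
  - have -> : 2^-1 = 1 - 16 / 32 :> R by field.
    by apply: sixth_power_decay; lra.
  - by have : n%:R * e <= n%:R * 4 by [rewrite ler_wpM2l //; lra]; lra.
have -> : n%:R ^+ 2 * (1 + a * e) ^+ 4 * (20 * e ^+ 2 * (1 - e / 32) ^+ n + 2 * 2^-1 ^+ n)
  = 20 * ((n%:R * e) ^+ 2 * (1 + a * e) ^+ 4 * (1 - e / 32) ^+ n)
    + 2 * (n%:R ^+ 2 * (1 + a * e) ^+ 4 * 2^-1 ^+ n).
  by move: (_ ^+ n) (_ ^+ n) => l k; ring.
by rewrite /decay_const; lra.
Qed.

(** A substitute for the square root of [n] which keeps [m ^ 2] an integer. *)
Lemma square_root_scale n : (0 < n)%N -> exists m, [/\ 2 <= m, n < m ^ 2 & m ^ 2 <= 4 * n]%N.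
Proof.
case: n => // n _; elim: n => [|n [m [m2 nm mn]]]; first by exists 2%N.
have [nm'|nm'] := ltnP n.+2 (m ^ 2); first by exists m; split=> //; lia.
by exists m.+1; split; nia.
Qed.

(** The layer sum is a mean of Riesz products over the parameter [w], a root of
    unity of order [m ^ 2]; the bound is dominated by the [w] with [|1 - w|] about
    [1 / m], that is, about [n^(-1/2)].  Weighting with the Poisson kernel, [tail]
    below bounds the contribution of each [w] to the fourth moment, and the weights
    sum to [O(m)] by [poisson_total], against the normalisation [m ^ 2]. *)
Lemma layer_fourth_moment n d y : (2 <= n)%N -> (d <= n)%N ->
  (3 * (2 ^ n - 1)).-primitive_root y ->
  n%:R ^+ 3 * (\sum_(t < 2 ^ n - 1 | t != 0%N :> nat) nsq (layer_sum n d (y ^+ 3 ^+ t)) ^+ 2)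
  <= 48 * decay_const * 16 ^+ n :> R.
Proof.
move=> n2 dn yP; have n0 : (0 < n)%N by lia.
have [m [m2 nm mn]] := square_root_scale n0.
have [e eP] : exists e : R[i], (m ^ 2).-primitive_root e.
  by apply: complex_prim_root_exists; lia.
pose u (s : 'I_(m ^ 2)) := poisson m (e ^+ s).
have u0 s : 0 < u s by apply: poisson_gt0; lia.
set U := \sum_s u s; have U2m : U <= 2 * m%:R := poisson_total m2 eP.
have U0 : 0 <= U by apply: sumr_ge0 => s _; apply: ltW.
set S := \sum_(t < _ | _) _; pose c := decay_const.
have nR : 0 < n%:R :> R by rewrite ltr0n.
have mR : n%:R <= m%:R ^+ 2 :> R by rewrite -natrX ler_nat ltnW.
have mR4 : m%:R ^+ 2 <= 4 * n%:R :> R by rewrite -natrX -natrM ler_nat.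
have m0 : 2 <= m%:R :> R by rewrite (ler_nat R 2 m).
have step (t : 'I_(2 ^ n - 1)) : ((m ^ 2)%:R ^+ 4) * nsq (layer_sum n d (y ^+ 3 ^+ t)) ^+ 2
  <= U ^+ 3 * \sum_(s < m ^ 2) nsq (riesz (e ^+ s) n (y ^+ 3 ^+ t)) ^+ 2 / u s ^+ 3.
  have -> : ((m ^ 2)%:R ^+ 4) * nsq (layer_sum n d (y ^+ 3 ^+ t)) ^+ 2
    = nsq ((m ^ 2)%:R * layer_sum n d (y ^+ 3 ^+ t)) ^+ 2.
    by rewrite nsqM -(rmorph_nat (real_complex R)) nsqR; ring.
  rewrite (layer_sum_riesz _ eP dn nm); apply: (le_trans (nsq_sum_fourth _ u0)).
  rewrite ler_wpM2l ?exprn_ge0 // le_eqVlt; apply/orP; left; apply/eqP; apply: eq_bigr => s _.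
  rewrite nsqM; have : nsq (conjc (e ^+ (s * d)) : R[i]) = nsq (e ^+ (s * d)).
    by case: (e ^+ _) => ? ?; rewrite /nsq /= sqrrN.
  by rewrite (nsq_prim_rootX _ eP) => ->; rewrite mul1r.
have tail (s : 'I_(m ^ 2)) : (\sum_(t < 2 ^ n - 1 | t != 0%N :> nat)
    nsq (riesz (e ^+ s) n (y ^+ 3 ^+ t)) ^+ 2) / u s ^+ 3 <= 3 * 16 ^+ n * (c / n%:R) * u s.
  have es1 := nsq_prim_rootX s eP.
  rewrite ler_pdivrMr ?exprn_gt0 //.
  apply: (le_trans (riesz_nontrivial_sum es1 n2 yP)); set B := (_ + _ : R).
  have : n%:R ^+ 2 * (u s)^-1 ^+ 4 * B <= c.
    rewrite /u /poisson invrK; apply: weighted_decay => //.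
    - exact: nsq_ge0.
    - exact: nsqB1_le4.
    - by rewrite mulr_ge0 //; lra.
    - by nra.
  move=> hB; have us := u0 s; have us4 : 0 < u s ^+ 4 / n%:R by rewrite divr_gt0 ?exprn_gt0.
  have -> : n%:R * (3 * 16 ^+ n * B) =
     3 * 16 ^+ n * (u s ^+ 4 / n%:R) * (n%:R ^+ 2 * (u s)^-1 ^+ 4 * B).
    by move: (16 ^+ n) => k; field; rewrite !gt_eqF.
  have -> : 3 * 16 ^+ n * (c / n%:R) * u s * u s ^+ 3 = 3 * 16 ^+ n * (u s ^+ 4 / n%:R) * c.
    by move: (16 ^+ n) => k; field; rewrite gt_eqF.
  by rewrite ler_wpM2l // mulr_ge0 ?(ltW us4) // mulr_ge0 ?exprn_ge0.
have total : (m ^ 2)%:R ^+ 4 * S <= U ^+ 4 * (3 * 16 ^+ n * (c / n%:R)).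
  apply: (@le_trans _ _ (U ^+ 3 * \sum_(s < m ^ 2) (3 * 16 ^+ n * (c / n%:R) * u s))); last first.
    by rewrite -mulr_sumr -/U le_eqVlt; apply/orP; left; apply/eqP; ring.
  rewrite /S mulr_sumr; apply: (le_trans (ler_sum _ (fun t _ => step t))).
  rewrite -mulr_sumr ler_wpM2l ?exprn_ge0 // exchange_big /=.
  by apply: ler_sum => s _; rewrite -mulr_suml.
have c0 : 0 < c := decay_const_gt0.
have k0 : 0 <= 16 ^+ n :> R by rewrite exprn_ge0.
have U4 : U ^+ 4 <= 16 * m%:R ^+ 4.
  have -> : 16 * m%:R ^+ 4 = (2 * m%:R) ^+ 4 :> R by ring.
  by apply: lerXn2r => //; rewrite nnegrE; lra.
have m4 : 0 < m%:R ^+ 4 :> R by rewrite exprn_gt0; lra.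
have S0 : 0 <= S by apply: sumr_ge0 => t _; apply: sqr_ge0.
rewrite -(ler_pM2l m4).
apply: (@le_trans _ _ (n%:R * ((m ^ 2)%:R ^+ 4 * S))).
  have -> : m%:R ^+ 4 * (n%:R ^+ 3 * S) = n%:R * m%:R ^+ 4 * S * n%:R ^+ 2 by ring.
  have -> : n%:R * ((m ^ 2)%:R ^+ 4 * S) = n%:R * m%:R ^+ 4 * S * (m%:R ^+ 2) ^+ 2 :> R.
    by rewrite natrX; ring.
  rewrite ler_wpM2l ?mulr_ge0 ?(ltW m4) ?(ltW nR) //.
  by apply: lerXn2r => //; rewrite nnegrE ?exprn_ge0 // ltW.
apply: (@le_trans _ _ (n%:R * (16 * m%:R ^+ 4 * (3 * 16 ^+ n * (c / n%:R))))).
  rewrite ler_wpM2l ?(ltW nR) //; apply: (le_trans total).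
  by rewrite ler_wpM2r // !mulr_ge0 ?invr_ge0 // ltW.
by rewrite -/c le_eqVlt; apply/orP; left; apply/eqP; move: (16 ^+ n) => k; field; rewrite gt_eqF.
Qed.

End FourthMoment.

(** * Sumsets in Z/NZ *)

Section Sumsets.
Variables (R : rcfType) (k : nat) (z : R[i]).
Hypothesis zP : (k.+2).-primitive_root z.
Implicit Types (A : {set 'I_k.+2}) (t a x : 'I_k.+2).

Definition fourier A t : R[i] := \sum_(x in A) z ^+ (t * x).

Definition representations A1 A2 x : R :=
  \sum_(a in A1) \sum_(b in A2) (a + b == x)%:R.

Lemma expr_addZp t a x : z ^+ (t * (a + x)%R) = z ^+ (t * a) * z ^+ (t * x).
Proof. by rewrite -exprD -mulnDr -(prim_expr_mod zP) modnMmr (prim_expr_mod zP). Qed.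

Lemma fourier_representations A1 A2 t :
  \sum_x (representations A1 A2 x)%:C%C * z ^+ (t * x) = fourier A1 t * fourier A2 t.
Proof.
rewrite /fourier mulr_suml.
under eq_bigr do rewrite rmorph_sum mulr_suml.
rewrite exchange_big /=; apply: eq_bigr => a _; rewrite mulr_sumr.
under eq_bigr do rewrite rmorph_sum mulr_suml.
rewrite exchange_big /=; apply: eq_bigr => b _.
rewrite (bigD1 (a + b)) //= eqxx mul1r big1 ?addr0 ?expr_addZp // => x.
by rewrite eq_sym => /negPf->; rewrite mul0r.
Qed.

Lemma representations_total A1 A2 :
  \sum_x representations A1 A2 x = #|A1|%:R * #|A2|%:R.
Proof.
rewrite exchange_big /= -!sum1_card !natr_sum mulr_suml; apply: eq_bigr => a _.
rewrite exchange_big /= mulr_sumr; apply: eq_bigr => b _.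
by rewrite (bigD1 (a + b)) //= eqxx big1 ?addr0 ?mulr1 // => x; rewrite eq_sym => /negPf->.
Qed.

(** Subtracting the mean removes exactly the trivial frequency. *)
Lemma fourier_variance A1 A2 :
  k.+2%:R * \sum_x (representations A1 A2 x - #|A1|%:R * #|A2|%:R / k.+2%:R) ^+ 2 =
  \sum_(t | t != 0) nsq (fourier A1 t) * nsq (fourier A2 t).
Proof.
set rho := _ / _; pose c x : R[i] := (representations A1 A2 x - rho)%:C%C.
have -> : \sum_x (representations A1 A2 x - rho) ^+ 2 = \sum_x nsq (c x).
  by apply: eq_bigr => x _; rewrite nsqR.
rewrite -(parseval _ zP) (bigD1 (0 : 'I_k.+2)) //=.
have split t : \sum_x c x * z ^+ (t * x) =
    fourier A1 t * fourier A2 t - rho%:C%C * \sum_(x < k.+2) z ^+ (t * x).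
  rewrite -fourier_representations mulr_sumr -sumrB; apply: eq_bigr => x _.
  by rewrite /c rmorphB mulrBl.
rewrite [X in nsq X](_ : _ = 0) ?nsq0 ?add0r.
  apply: eq_bigr => t t0; rewrite split.
  have zt : z ^+ t != 1 by rewrite -(prim_order_dvd zP) gtnNdvd ?lt0n.
  rewrite (_ : \sum_(x < _) _ = 0) ?mulr0 ?subr0 ?nsqM //.
  apply/eqP; rewrite -(mulrI_eq0 _ (mulfI (_ : z ^+ t - 1 != 0))) ?subr_eq0 //.
  under eq_bigr do rewrite exprM.
  by rewrite -subrX1 exprAC (prim_expr_order zP) expr1n subrr.
transitivity (\sum_x c x).
  by apply: eq_bigr => x _; rewrite mul0n expr0 mulr1.
rewrite -rmorph_sum sumrB representations_total sumr_const card_ord -(mulr_natr rho).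
by rewrite /rho divfK ?subrr // pnatr_eq0.
Qed.

(** Chebyshev's inequality: at a missing sum the number of representations is 0, so
    it deviates from the mean by the whole mean. *)
Lemma missing_sums_bound A1 A2 :
  #|~: [set s1 + s2 | s1 in A1, s2 in A2]|%:R * (#|A1|%:R * #|A2|%:R) ^+ 2 <=
  k.+2%:R * \sum_(t | t != 0) nsq (fourier A1 t) * nsq (fourier A2 t).
Proof.
set T := ~: _; rewrite -fourier_variance; set P := #|A1|%:R * _.
have N0 : k.+2%:R != 0 :> R by rewrite pnatr_eq0.
have -> : #|T|%:R * P ^+ 2 = k.+2%:R * (k.+2%:R * (#|T|%:R * (P / k.+2%:R) ^+ 2)).
  by move: (k.+2%:R) N0 => N N0; field.
rewrite !ler_wpM2l // -sum1_card natr_sum mulr_suml [leRHS](bigID (mem T)) /=.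
rewrite -[leLHS]addr0 lerD ?sumr_ge0 // => [|x _]; last exact: sqr_ge0.
apply: ler_sum => x; rewrite inE => xT.
suff -> : representations A1 A2 x = 0 by rewrite mul1r sub0r sqrrN.
rewrite /representations big1 // => a aA; rewrite big1 // => b bA.
by case: eqP => // abx; case/negP: xT; rewrite -abx imset2_f.
Qed.

Lemma fourier_dilate A a t : a \is a GRing.unit ->
  fourier [set a * x | x in A] t = fourier A (t * a).
Proof.
move=> aU; rewrite /fourier big_imset /=; last by move=> x y _ _; apply: mulrI.
apply: eq_bigr => x _; rewrite -(prim_expr_mod zP) modnMmr (prim_expr_mod zP).
by rewrite -[RHS](prim_expr_mod zP) modnMml (prim_expr_mod zP) mulnA.
Qed.

Lemma fourier_dilate_fourth A a : a \is a GRing.unit ->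
  \sum_(t | t != 0) nsq (fourier [set a * x | x in A] t) ^+ 2 =
  \sum_(t | t != 0) nsq (fourier A t) ^+ 2.
Proof.
move=> aU; rewrite [RHS](reindex_inj (mulIr aU)); apply: eq_big => t.
  by rewrite (mulIr_eq0 _ (mulIr aU)).
by rewrite fourier_dilate.
Qed.

(** Dilation by a unit permutes the nonzero frequencies, so that after separating
    the two factors by [2 x y <= x^2 + y^2] the units disappear. *)
Lemma missing_dilated_sums_bound A1 A2 a1 a2 (B : R) :
  a1 \is a GRing.unit -> a2 \is a GRing.unit ->
  \sum_(t | t != 0) nsq (fourier A1 t) ^+ 2 <= B ->
  \sum_(t | t != 0) nsq (fourier A2 t) ^+ 2 <= B ->
  #|~: [set s1 + s2 | s1 in [set a1 * x | x in A1], s2 in [set a2 * x | x in A2]]|%:R *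
    (#|A1|%:R ^+ 2 * #|A2|%:R ^+ 2) <= k.+2%:R * B.
Proof.
move=> a1U a2U B1 B2; rewrite -exprMn.
have := missing_sums_bound [set a1 * x | x in A1] [set a2 * x | x in A2].
rewrite !card_imset; try exact: mulrI.
move=> h; apply: (le_trans h); rewrite ler_wpM2l //.
move: B1 B2; rewrite -(fourier_dilate_fourth A1 a1U) -(fourier_dilate_fourth A2 a2U).
set F1 := fourier _; set F2 := fourier _ => B1 B2.
apply: (@le_trans _ _ (\sum_(t | t != 0) (nsq (F1 t) ^+ 2 / 2 + nsq (F2 t) ^+ 2 / 2))).
  by apply: ler_sum => t _; have := sqr_ge0 (nsq (F1 t) - nsq (F2 t)); lra.
by rewrite big_split /= -!mulr_suml; lra.
Qed.

End Sumsets.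

(** * Layers in the ring of residues modulo a Mersenne number *)

Section MersenneLayers.
Variable R : rcfType.

Lemma Zp_trunc_mersenne n : (2 <= n)%N -> (Zp_trunc (mersenne n)).+2 = (2 ^ n - 1)%N.
Proof.
move=> n2; rewrite Zp_cast // /mersenne.
by have : (2 ^ 2 <= 2 ^ n)%N by [rewrite leq_exp2l]; lia.
Qed.

Lemma layer_nonempty n w : (2 <= n)%N -> (w < n)%N -> (0 < #|layer n w|)%N.
Proof.
move=> n2 wn; have [x xn xw] := digit_sum_onto (ltnW wn).
have xN : (x < (Zp_trunc (mersenne n)).+2)%N.
  rewrite (Zp_trunc_mersenne n2); have : x != (2 ^ n - 1)%N; last by lia.
  by apply: contraTneq wn => xE; rewrite -leqNgt -xw xE digit_sum_full.
by apply/card_gt0P; exists (Ordinal xN); rewrite inE; apply/eqP.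
Qed.

Lemma fourier_layer n w (z : R[i]) (t : zmers n) : (2 <= n)%N -> (w < n)%N ->
  fourier z (layer n w) t = layer_sum n w (z ^+ t).
Proof.
move=> n2 wn; rewrite /fourier /layer_sum.
pose F x := z ^+ t ^+ x; pose P x := digit_sum n x == w.
rewrite (eq_big (fun x : zmers n => P x) (fun x => F x)) => [||x _]; last 2 first.
- by move=> x; rewrite inE.
- by rewrite /F exprM.
rewrite -(big_mkord P F) -[RHS](big_mkord P F) (Zp_trunc_mersenne n2).
have -> : (2 ^ n = (2 ^ n - 1).+1)%N by rewrite subn1 prednK ?expn_gt0.
(* The integer [2 ^ n - 1], which has no residue of its own, has digit sum [n]. *)
rewrite subSS subn0 [RHS]big_mkcond big_nat_recr //= -big_mkcond /=.
by rewrite /P digit_sum_full gtn_eqF // addr0.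
Qed.

Lemma missing_layer_sums n (a1 a2 : zmers n) w1 w2 : (2 <= n)%N ->
  a1 \is a GRing.unit -> a2 \is a GRing.unit -> (w1 < n)%N -> (w2 < n)%N ->
  #|~: supp_add (dilate a1 (layer n w1)) (dilate a2 (layer n w2))|%:R *
    (#|layer n w1|%:R ^+ 2 * #|layer n w2|%:R ^+ 2) * n%:R ^+ 3
  <= 768 * decay_const R * (mersenne n)%:R ^+ 5.
Proof.
move=> n2 a1U a2U w1n w2n; set N := mersenne n.
have N4 : (2 ^ 2 <= 2 ^ n)%N by rewrite leq_exp2l.
have [y yP] : exists y : R[i], (3 * (2 ^ n - 1)).-primitive_root y.
  by apply: complex_prim_root_exists; lia.
have NE := Zp_trunc_mersenne n2.
have zP : ((Zp_trunc N).+2).-primitive_root (y ^+ 3).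
  rewrite NE; have := dvdn_prim_root yP (dvdn_mull 3 (dvdnn (2 ^ n - 1))).
  by rewrite mulnK //; lia.
have n0 : 0 < n%:R ^+ 3 :> R by rewrite exprn_gt0 // ltr0n ltnW.
have fourth w : (w < n)%N ->
    \sum_(t : zmers n | t != 0) nsq (fourier (y ^+ 3) (layer n w) t) ^+ 2
    <= 48 * decay_const R * 16 ^+ n / n%:R ^+ 3.
  move=> wn; rewrite ler_pdivlMr // mulrC.
  have := layer_fourth_moment n2 (ltnW wn) yP.
  pose F t := nsq (layer_sum n w (y ^+ 3 ^+ t)) ^+ 2.
  rewrite -(big_mkord (fun t => t != 0%N) F) -NE big_mkord => h.
  apply: le_trans h; rewrite ler_wpM2l ?(ltW n0) // le_eqVlt; apply/orP; left; apply/eqP.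
  by apply: eq_big => // t _; rewrite /F fourier_layer.
have h := missing_dilated_sums_bound zP a1U a2U (fourth _ w1n) (fourth _ w2n).
rewrite -ler_pdivlMr //; apply: (le_trans h).
have NN : (2 ^ n <= 2 * N)%N by rewrite /N /mersenne; lia.
have -> : (Zp_trunc N).+2 = N by rewrite NE.
rewrite mulrA ler_wpM2r ?invr_ge0 ?(ltW n0) //.
have c0 := ltW (decay_const_gt0 R).
have -> : 16 ^+ n = (2 ^ n)%:R ^+ 4 :> R by rewrite natrX -exprM mulnC exprM; congr (_ ^+ n); ring.
have : (2 ^ n)%:R ^+ 4 <= (2 * N%:R) ^+ 4 :> R.
  by apply: lerXn2r; rewrite ?nnegrE ?mulr_ge0 // -natrM ler_nat.
move=> p4; have := ler_wpM2l (mulr_ge0 (ler0n R N) c0) p4.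
lra.
Qed.

End MersenneLayers.

(** * Missing sums of dilated layers *)

Lemma powR_three_quarters (R : realType) (n : nat) : (0 < n)%N ->
  (n%:R `^ (- (3%:R / 4%:R)) : R) ^+ 4 = n%:R ^- 3.
Proof.
move=> n0; rewrite -powR_mulrn ?powR_ge0 // -powRrM.
have -> : - (3%:R / 4%:R) * 4%:R = - 3%:R :> R by field.
by rewrite powRN powR_mulrn.
Qed.

Lemma card_zmers n : (2 <= n)%N -> #|{: zmers n}| = mersenne n.
Proof. by move=> n2; rewrite card_ord (Zp_trunc_mersenne n2). Qed.

Theorem theorem2 (R : realType) :
  (exists C : R, 0 < C /\
    forall n : nat, (3 <= n)%N ->
    forall a1 a2 : zmers n, a1 \is a GRing.unit -> a2 \is a GRing.unit ->
    forall w1 w2 : nat, (w1 < n)%N -> (w2 < n)%N ->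
      #|~: supp_add (dilate a1 (layer n w1)) (dilate a2 (layer n w2))|%:R
      <= C * (mersenne n)%:R *
         Num.min 1 ((mersenne n)%:R ^+ 4 * n%:R ^- 3 /
                    (#|layer n w1|%:R ^+ 2 * #|layer n w2|%:R ^+ 2)))
  /\
  (forall (w1 w2 : nat -> nat) (a1 a2 : forall n : nat, zmers n),
    (forall n : nat, (3 <= n)%N ->
      [/\ (w1 n < n)%N, (w2 n < n)%N,
          a1 n \is a GRing.unit & a2 n \is a GRing.unit]) ->
    ((#|layer n (w1 n)|%:R * #|layer n (w2 n)|%:R /
       ((mersenne n)%:R * n%:R `^ (- (3%:R / 4%:R))) ^+ 2 : R)
      @[n --> \oo] --> +oo%R)%classic ->
    exists2 e : nat -> R, (e n @[n --> \oo] --> (0 : R))%classic &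
      forall n : nat, (3 <= n)%N ->
        #|supp_add (dilate (a1 n) (layer n (w1 n)))
                   (dilate (a2 n) (layer n (w2 n)))|%:R
        = (1 - e n) * (mersenne n)%:R).
Proof.
have c0 := decay_const_gt0 R.
have N0 n : (3 <= n)%N -> 0 < (mersenne n)%:R :> R.
  by move=> n3; rewrite ltr0n subn_gt0 -[X in (X < _)%N](expn0 2) ltn_exp2l //; lia.
(* The summand 1 makes [C >= 1], as the trivial bound by [N] requires. *)
pose C : R := 1 + 768 * decay_const R.
have C0 : 0 < C by rewrite /C; lra.
have missing n : (3 <= n)%N -> forall a1 a2 : zmers n,
    a1 \is a GRing.unit -> a2 \is a GRing.unit ->
    forall w1 w2, (w1 < n)%N -> (w2 < n)%N ->
    #|~: supp_add (dilate a1 (layer n w1)) (dilate a2 (layer n w2))|%:R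
    <= C * (mersenne n)%:R * ((mersenne n)%:R ^+ 4 * n%:R ^- 3 /
         (#|layer n w1|%:R ^+ 2 * #|layer n w2|%:R ^+ 2)).
  move=> n3 a1 a2 a1U a2U w1 w2 w1n w2n; have n2 : (2 <= n)%N by lia.
  have n0 : 0 < n%:R :> R by rewrite ltr0n; lia.
  have L w : (w < n)%N -> 0 < #|layer n w|%:R :> R by move=> wn; rewrite ltr0n layer_nonempty.
  have := missing_layer_sums R n2 a1U a2U w1n w2n.
  move: (L _ w1n) (L _ w2n); set l1 := #|layer n w1|%:R; set l2 := #|layer n w2|%:R.
  set T := #|_|%:R; have := N0 n n3; move: ((mersenne n)%:R : R) => N Npos l1p l2p h.
  have D0 : 0 < l1 ^+ 2 * l2 ^+ 2 * n%:R ^+ 3 by rewrite !mulr_gt0 ?exprn_gt0.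
  have -> : C * N * (N ^+ 4 * n%:R ^- 3 / (l1 ^+ 2 * l2 ^+ 2))
     = C * N ^+ 5 / (l1 ^+ 2 * l2 ^+ 2 * n%:R ^+ 3).
    by field; rewrite !gt_eqF.
  rewrite ler_pdivlMr // mulrA; apply: (le_trans h).
  by rewrite ler_wpM2r ?exprn_ge0 ?(ltW Npos) // /C; lra.
split.
  exists C; split=> // n n3 a1 a2 a1U a2U w1 w2 w1n w2n.
  rewrite minEle; case: ifP => _; last exact: missing.
  rewrite mulr1; apply: (@le_trans _ _ (mersenne n)%:R).
    by rewrite ler_nat; apply: leq_trans (max_card _) _; rewrite card_zmers //; lia.
  by rewrite ler_peMl ?(ltW (N0 n n3)) // /C; lra.
move=> w1 w2 a1 a2 wa; set X := fun n : nat => (_ / _ : R) => Xoo.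
pose S n := supp_add (dilate (a1 n) (layer n (w1 n))) (dilate (a2 n) (layer n (w2 n))).
exists (fun n => #|~: S n|%:R / (mersenne n)%:R); last first.
  move=> n n3; have Nn := N0 n n3; have n2 : (2 <= n)%N by lia.
  rewrite mulrBl mul1r divfK ?gt_eqF //.
  have := cardsC (S n); rewrite (card_zmers n2) => NE.
  by rewrite -[X in X%:R - _]NE natrD addrK.
apply/cvgrPdist_lt => eps eps0.
have X1 := (cvgryPgt _).1 Xoo 1; have X2 := (cvgryPgt _).1 Xoo (C / eps).
near=> n.
have n3 : (3 <= n)%N by near: n; exact: nbhs_infty_ge.
have X1n : 1 < X n by near: n; exact: X1.
have X2n : C / eps < X n by near: n; exact: X2.
have [w1n w2n a1U a2U] := wa n n3; have Nn := N0 n n3.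
have h := missing n n3 _ _ a1U a2U _ _ w1n w2n.
rewrite sub0r normrN ger0_norm ?divr_ge0 ?(ltW Nn) // ltr_pdivrMr //.
apply: (le_lt_trans h); rewrite -mulrA mulrCA mulrC ltr_pM2r //.
have n2 : (2 <= n)%N := ltnW n3; have n0 : (0 < n)%N := ltnW n2.
have n0R : 0 < n%:R :> R by rewrite ltr0n.
have l w : (w < n)%N -> 0 < #|layer n w|%:R :> R.
  by move=> wn; rewrite ltr0n (layer_nonempty n2 wn).
have -> : (mersenne n)%:R ^+ 4 * n%:R ^- 3 /
   (#|layer n (w1 n)|%:R ^+ 2 * #|layer n (w2 n)|%:R ^+ 2) = (X n)^-1 ^+ 2 :> R.
  rewrite -powR_three_quarters // /X.
  have := powR_gt0 (- (3%:R / 4%:R)) n0R; move: (_ `^ _) => p p0.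
  by field; rewrite !gt_eqF ?l.
have X0 : 0 < X n by lra.
rewrite exprVn -[ltLHS]/(C / _) ltr_pdivrMr ?exprn_gt0 //.
move: X2n; rewrite ltr_pdivrMr // => X2n; nra.
Unshelve. all: by end_near.
Qed.
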